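(* Consider the Top-$k$ problem ($1\le k<K$, including best arm identification $k=1$) or the thresholding bandit problem with threshold $\tau\in\mathbb{R}$. For all $\mu\in\mathbb{R}^K$ and all $\varepsilon\ge0$, $$\overline T^\star(\mathcal B_\infty(\mu,\varepsilon))=\max_{\mu'\in\mathcal B_\infty(\mu,\varepsilon)}T^\star(\mu').$$
   Context: Fix $K$ arms and $\sigma>0$; $\Sigma_K$ is the probability simplex of $\mathbb{R}^K$ and $\mathcal B_\infty(\mu,\varepsilon)=\{\nu\in\mathbb{R}^K:\|\nu-\mu\|_\infty\le\varepsilon\}$. Top-$k$ problem: for $\mu$ whose $k$-th largest entry is strictly larger than its $(k+1)$-th largest entry, the correct answer $i^\star(\mu)$ is the set of the $k$ indices with largest entries. Thresholding bandit problem: for $\mu$ with $\mu_i\neq\tau$ for all $i$, $i^\star(\mu)=\{i:\mu_i>\tau\}$. For $\mu$ with a well-defined correct answer, $Alt_\mu$ is the set of vectors $\lambda$ with a well-defined correct answer and $i^\star(\lambda)\ne i^\star(\mu)$; for the other $\mu$ (ties), $Alt_\mu=\mathbb{R}^K$, so that $T^\star(\mu)=+\infty$. With $0^{-1}=+\infty$, for $\mu\in\mathbb{R}^K$ and $B\subseteq\mathbb{R}^K$, $$T^\star(\mu)=\left(\sup_{w\in\Sigma_K}\inf_{\lambda\in Alt_\mu}\sum_iw_i\tfrac{(\mu_i-\lambda_i)^2}{2\sigma^2}\right)^{-1},\qquad\overline T^\star(B)=\left(\max_{w\in\Sigma_K}\inf_{\nu\in B}\inf_{\lambda\in Alt_\nu}\sum_iw_i\tfrac{(\nu_i-\lambda_i)^2}{2\sigma^2}\right)^{-1}.$$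 *)

(* Defs.v *)
From HB Require Import structures.
From mathcomp Require Import all_boot all_order all_algebra.
From mathcomp Require Import all_classical all_reals all_analysis.

Set Implicit Arguments.
Unset Strict Implicit.
Unset Printing Implicit Defensive.

Import Order.TTheory GRing.Theory Num.Theory.
Import numFieldNormedType.Exports.

Local Open Scope classical_set_scope.
Local Open Scope ring_scope.

(* The norm on 'rV[R]_K is the sup norm. The library's closed_ball is the
   closure of the open ball, hence empty for eps = 0, so it is not used. *)
Definition linfty_ball (R : realType) (K : nat) (mu : 'rV[R]_K) (eps : R) :
    set 'rV[R]_K :=
  [set nu | `|nu - mu| <= eps].

Definition simplex (R : realType) (K : nat) : set 'rV[R]_K :=
  [set w | (forall i, 0 <= w ord0 i) /\ \sum_(i < K) w ord0 i = 1].

(* Correct-answer maps are partial: None means that the correct answer is not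
   well defined (a tie). *)
Definition answer_map (R : realType) (K : nat) :=
  'rV[R]_K -> option {set 'I_K}.

(* k is counted from 1, with multiplicity. *)
Definition kth_largest (R : realType) (K : nat) (mu : 'rV[R]_K) (k : nat) : R :=
  nth 0 (sort >=%R [seq mu ord0 i | i : 'I_K]) k.-1.

Definition top_k_answer (R : realType) (K k : nat) : answer_map R K := fun mu =>
  if kth_largest mu k.+1 < kth_largest mu k
  then Some [set i | kth_largest mu k <= mu ord0 i]%SET
  else None.

Definition thresholding_answer (R : realType) (K : nat) (tau : R) :
    answer_map R K := fun mu =>
  if [forall i, mu ord0 i != tau] then Some [set i | tau < mu ord0 i]%SET
  else None.

Definition alt (R : realType) (K : nat) (istar : answer_map R K)
    (mu : 'rV[R]_K) : set 'rV[R]_K :=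
  if istar mu is Some A
  then [set lam | exists2 A', istar lam = Some A' & A' <> A]
  else setT.

Definition transport_cost (R : realType) (K : nat) (sigma : R)
    (w mu lam : 'rV[R]_K) : R :=
  \sum_(i < K) w ord0 i * ((mu ord0 i - lam ord0 i) ^+ 2 / (2 * sigma ^+ 2)).

Definition inf_cost (R : realType) (K : nat) (istar : answer_map R K)
    (sigma : R) (w mu : 'rV[R]_K) : \bar R :=
  ereal_inf [set (transport_cost sigma w mu lam)%:E | lam in alt istar mu].

Definition robust_inf_cost (R : realType) (K : nat) (istar : answer_map R K)
    (sigma : R) (B : set 'rV[R]_K) (w : 'rV[R]_K) : \bar R :=
  ereal_inf [set inf_cost istar sigma w nu | nu in B].

(* The inverse on \bar R satisfies 0^-1 = +oo. *)
Definition Tstar (R : realType) (K : nat) (istar : answer_map R K)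
    (sigma : R) (mu : 'rV[R]_K) : \bar R :=
  ((ereal_sup [set inf_cost istar sigma w mu | w in @simplex R K])^-1)%E.

(* The supremum over the simplex is meant to be a maximum: that it is attained
   has to be stated separately. *)
Definition Tstar_bar (R : realType) (K : nat) (istar : answer_map R K)
    (sigma : R) (B : set 'rV[R]_K) : \bar R :=
  ((ereal_sup [set robust_inf_cost istar sigma B w | w in @simplex R K])^-1)%E.

Definition is_max (R : realType) (A : set (\bar R)) (m : \bar R) : Prop :=
  A m /\ ubound A m.

(* Main.v *)
(* The transport cost is invariant under translating both arguments, so only the
   position of nu relative to its answer S matters. If the ball contains no tie,
   the answer is constant on it (it is locally constant along segments), and the
   point nu obtained from mu by lowering the arms of S and raising the others by
   eps is worst simultaneously for all weights w: given nu' in the ball and an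
   alternative lam of nu', the point lam + (nu - nu') has the same cost from nu
   and can only be further from having the answer S. If the ball contains a tie,
   that tie is worst, with value 0. Hence the robust problem over the ball is the
   plain problem at a single point, and no minimax argument is needed. *)

Require Import Defs.
From HB Require Import structures.
From mathcomp Require Import all_boot all_order all_algebra.
From mathcomp Require Import all_classical all_reals all_analysis.
Import Order.TTheory GRing.Theory Num.Theory.
Import numFieldNormedType.Exports.
Local Open Scope classical_set_scope.
Local Open Scope ring_scope.

Set Implicit Arguments.
Unset Strict Implicit.
Unset Printing Implicit Defensive.

(** * Order statistics and the Top-k answer *)

Lemma leq_nth_sorted_ge (R : realType) (s : seq R) (a : R) (i : nat) :
  sorted >=%R s -> (i < size s)%N ->
  (a <= nth 0 s i) = (i < count (>= a) s)%N.
Proof.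
elim: s i => //= x s IHs i ss; case: i => [_|i].
  case: (leP a x) => [//|xa] /=; apply/esym/negbTE.
  rewrite -leqNgt leqn0 add0n -leqn0 leqNgt -has_count -all_predC.
  have := order_path_min (fun _ _ _ h1 h2 => le_trans h2 h1) ss.
  by apply: sub_all => y /= yx; rewrite -ltNge (le_lt_trans yx).
rewrite ltnS => ilt; rewrite IHs ?(path_sorted ss)//.
case: (leP a x) => //= xa; rewrite add0n.
(* The head is already below [a] and dominates the tail, so no entry of the tail reaches [a]. *)
have -> : count (>= a) s = 0%N; last by rewrite !ltn0.
apply/eqP; rewrite -leqn0 leqNgt -has_count -all_predC.
have := order_path_min (fun _ _ _ h1 h2 => le_trans h2 h1) ss.
by apply: sub_all => y /= yx; rewrite -ltNge (le_lt_trans yx).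
Qed.

(** Trades the sorted sequence for the cardinality of a level set, so that the Top-k answer can be
    characterised by counting. *)
Lemma le_kth_largest (R : realType) (K k : nat) (x : 'rV[R]_K) (a : R) :
  (0 < k <= K)%N -> (a <= kth_largest x k) = (k <= #|[set i | (a <= x ord0 i)%R]%SET|)%N.
Proof.
case: k => [//|k] /= kK; rewrite /kth_largest leq_nth_sorted_ge/=.
- have /permP-> := permEl (perm_sort >=%R [seq x ord0 i | i : 'I_K]).
  rewrite count_map -sum1_count big_enum_cond sum1dep_card.
  by congr (_ < #|_|)%N; apply/setP => i; rewrite !inE.
- by apply: sort_sorted => u v; exact: le_total.
- by rewrite size_sort size_image card_ord.
Qed.

Lemma top_k_answerP (R : realType) (K k : nat) (x : 'rV[R]_K) (S : {set 'I_K}) :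
  (0 < k < K)%N ->
  top_k_answer k x = Some S <->
  #|S| = k /\ forall i j, i \in S -> j \notin S -> x ord0 j < x ord0 i.
Proof.
move=> /andP[k0 kK].
have k1P := le_kth_largest x _ (k := k.+1) kK.
have kP a : (a <= kth_largest x k) = (k <= #|[set i | (a <= x ord0 i)%R]%SET|)%N.
  by rewrite le_kth_largest// k0 ltnW.
rewrite /top_k_answer; split.
  case: ifPn => // lt_kk [<-]; split.
    (* Reflexivity at the k-th value gives at least [k] arms; the strict gap to the next value rules
       out [k.+1]. *)
    apply/eqP; rewrite eqn_leq -kP lexx andbT leqNgt -k1P.
    by rewrite -ltNge.
  by move=> i j; rewrite !inE -ltNge => le_i lt_j; exact: lt_le_trans le_i.
move=> [cardS sepS].
have /card_gt0P[i0 i0S] : (0 < #|S|)%N by rewrite cardS.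
(* The smallest entry over [S] is a threshold whose upper level set is exactly [S]; it therefore
   separates the two order statistics. *)
have [m mS mmin] : exists2 m, m \in S & forall i, i \in S -> x ord0 m <= x ord0 i.
  by case: (@arg_minP _ _ _ i0 (mem S) (fun i => x ord0 i) i0S) => m ? ?; exists m.
have geS : [set i | x ord0 m <= x ord0 i]%SET = S.
  apply/setP => i; rewrite inE; case: (boolP (i \in S)) => [/mmin //|iS].
  by apply/negbTE; rewrite -ltNge; exact: sepS.
have le_m : x ord0 m <= kth_largest x k by rewrite kP geS cardS.
have lt_m : kth_largest x k.+1 < x ord0 m.
  by rewrite ltNge k1P geS cardS ltnn.
rewrite (lt_le_trans lt_m le_m); congr Some; apply/eqP.
rewrite eqEcard cardS -kP lexx andbT -geS; apply/fintype.subsetP => i.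
by rewrite !inE; exact: le_trans.
Qed.

Lemma top_k_answer_inj_neqNone (R : realType) (K k : nat) (x : 'rV[R]_K) :
  (0 < k < K)%N -> injective (x ord0) -> top_k_answer k x <> None.
Proof.
case: k => [//|k] /= kK xinj; rewrite /top_k_answer /kth_largest/=.
set s := sort _ _; have sizes : size s = K by rewrite size_sort size_image card_ord.
have uniqs : uniq s by rewrite sort_uniq map_inj_uniq ?enum_uniq.
have ss : sorted >=%R s by apply: sort_sorted => u v; exact: le_total.
case: ifPn => //; rewrite lt_neqAle negb_and negbK => /orP[|/negP[]].
  by rewrite nth_uniq ?sizes ?kK ?(ltnW kK)// gtn_eqF.
by apply: (sortedP 0 ss); rewrite sizes.
Qed.

(* For small t <> 0, adding t times this vector breaks all ties: lam + (nu - nu')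
   may itself be a tie, and is then only a limit of alternatives of nu. *)
Definition ramp (R : realType) (K : nat) : 'rV[R]_K := \row_i i.+1%:R.

(** The interface between the two problems and the rest of the argument: [answer_mono] compares
    points of the ball, [answer_open] gives local constancy, and [answer_generic] perturbs ties
    away. *)
Record regular_answer (R : realType) (K : nat) (istar : answer_map R K) : Prop :=
  RegularAnswer {
    answer_mono : forall (x y : 'rV[R]_K) (S : {set 'I_K}),
      istar x = Some S ->
      (forall i, i \in S -> x ord0 i <= y ord0 i) ->
      (forall i, i \notin S -> y ord0 i <= x ord0 i) ->
      istar y = Some S;
    answer_open : forall (x : 'rV[R]_K) (S : {set 'I_K}),
      istar x = Some S -> \forall y \near x, istar y = Some S;
    answer_generic : forall x : 'rV[R]_K,
      \forall t \near (0 : R)^', istar (x + t *: ramp R K) <> None }.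

(** * Regularity of the two answer maps *)

Lemma near_lt (R : realType) (T : topologicalType) (f g : T -> R) (x : T) :
  {for x, continuous f} -> {for x, continuous g} ->
  f x < g x -> \forall y \near x, f y < g y.
Proof.
move=> cf cg fg.
have cfg : (f y - g y) @[y --> x] --> f x - g x by exact: cvgB.
have fg0 : f x - g x < 0 by rewrite subr_lt0.
by apply: filterS (cvgr_lt _ cfg _ fg0) => y; rewrite subr_lt0.
Qed.

Lemma cvg_affine0 (R : realType) (a b : R) :
  a + t * b @[t --> (0 : R)^'] --> a.
Proof.
rewrite -[X in _ --> X]addr0 -[X in _ --> _ + X](mul0r b).
apply: cvgD; first exact: cvg_cst.
by apply: cvgMl; exact: nbhs_dnbhs.
Qed.

Lemma near_affine_neq0 (R : realType) (a b : R) :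
  b != 0 -> \forall t \near (0 : R)^', a + t * b != 0.
Proof.
move=> b0; have [->|a0] := eqVneq a 0.
  by apply: filterS (nbhs_dnbhs_neq _) => t t0; rewrite add0r mulf_neq0.
by apply: (cvgr_neq0 a) => //; exact: cvg_affine0.
Qed.

(** Along the ramp, the difference of two distinct coordinates is affine in [t] with nonzero slope,
    so it does not vanish for small nonzero [t]; there are finitely many pairs. *)
Lemma near_ramp_inj (R : realType) (K : nat) (x : 'rV[R]_K) :
  \forall t \near (0 : R)^', injective ((x + t *: ramp R K) ord0).
Proof.
have : \forall t \near (0 : R)^', forall ij : 'I_K * 'I_K, ij.1 != ij.2 ->
    (x ord0 ij.1 - x ord0 ij.2) + t * (ij.1.+1%:R - ij.2.+1%:R) != 0.
  apply: filter_forall => -[i j]/=; have [->|ij] := eqVneq i j; first exact: nearW.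
  have ij0 : (i.+1%:R - j.+1%:R : R) != 0 by rewrite subr_eq0 eqr_nat eqSS.
  by apply: filterS (near_affine_neq0 (x ord0 i - x ord0 j) ij0).
apply: filterS => t xt i j; rewrite !mxE => ij; apply/eqP/negPn/negP => /(xt (i, j))/=.
by rewrite mulrBr addrACA -opprD ij subrr eqxx.
Qed.

Lemma top_k_answer_regular (R : realType) (K k : nat) :
  (0 < k < K)%N -> regular_answer (@top_k_answer R K k).
Proof.
move=> kK; split => [x y S|x S|x].
- move=> /top_k_answerP-/(_ kK)[cardS sepS] geS leS; apply/top_k_answerP => //.
  split=> // i j iS jS; apply: le_lt_trans (leS _ jS) _.
  exact: lt_le_trans (sepS _ _ iS jS) (geS _ iS).
- move=> /top_k_answerP-/(_ kK)[cardS sepS].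
  have : \forall y \near x, forall ij : 'I_K * 'I_K,
      ij.1 \in S -> ij.2 \notin S -> (y : 'rV[R]_K) ord0 ij.2 < y ord0 ij.1.
    apply: (@filter_forall 'rV[R]_K _ _ (nbhs x)) => -[i j]/=.
    have [iS|] := boolP (i \in S); last by move=> _; exact: nearW.
    have [|jS] := boolP (j \in S); first by move=> _; exact: nearW.
    have := near_lt (@coord_continuous R 1 K ord0 j x)
      (@coord_continuous R 1 K ord0 i x) (sepS _ _ iS jS).
    exact: filterS.
  apply: filterS => y sepy; apply/top_k_answerP => //; split=> // i j.
  exact: (sepy (i, j)).
- by apply: filterS (near_ramp_inj x) => t; exact: top_k_answer_inj_neqNone.
Qed.

Lemma thresholding_answerP (R : realType) (K : nat) (tau : R) (x : 'rV[R]_K)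
    (S : {set 'I_K}) :
  thresholding_answer tau x = Some S <->
  forall i, if i \in S then tau < x ord0 i else x ord0 i < tau.
Proof.
rewrite /thresholding_answer; split.
  case: ifPn => // /forallP xtau [<-] i; rewrite inE.
  by case: ltgtP (xtau i) => // ->; rewrite eqxx.
move=> xS; have -> : [forall i, x ord0 i != tau].
  apply/forallP => i; move: (xS i); case: ifP => _; first by move/gt_eqF->.
  by move/lt_eqF->.
congr Some; apply/setP => i; rewrite inE; move: (xS i).
by case: ifP => _ // /ltW; rewrite leNgt => /negbTE.
Qed.

Lemma thresholding_answer_regular (R : realType) (K : nat) (tau : R) :
  regular_answer (@thresholding_answer R K tau).
Proof.
split=> [x y S|x S|x].
- move=> /thresholding_answerP xS geS leS; apply/thresholding_answerP => i.
  move: (xS i); case: ifPn => iS xi; first exact: lt_le_trans (geS _ iS).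
  exact: le_lt_trans (leS _ iS) _.
- move=> /thresholding_answerP xS.
  have : \forall y \near x, forall i,
      if i \in S then tau < (y : 'rV[R]_K) ord0 i else y ord0 i < tau.
    apply: (@filter_forall 'rV[R]_K _ _ (nbhs x)) => i; move: (xS i).
    have ci := @coord_continuous R 1 K ord0 i x.
    have ctau := @cst_continuous 'rV[R]_K R tau x.
    by case: ifP => _; [exact: (near_lt ctau ci) | exact: (near_lt ci ctau)].
  by apply: filterS => y yS; apply/thresholding_answerP.
- have : \forall t \near (0 : R)^', forall i : 'I_K,
      (x ord0 i - tau) + t * i.+1%:R != 0.
    by apply: filter_forall => i; apply: near_affine_neq0; rewrite pnatr_eq0.
  apply: filterS => t xt; rewrite /thresholding_answer ifT//.
  by apply/forallP => i; rewrite !mxE -subr_eq0 addrAC.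
Qed.

(** * Attainment of suprema over the simplex *)

Lemma ereal_lt_dense (R : realType) (x y : \bar R) :
  (x < y)%E -> exists c : R, (x < c%:E)%E /\ (c%:E < y)%E.
Proof.
case: x y => [r| |] [s| |] //= xy.
- exists ((r + s) / 2); rewrite !lte_fin in xy *.
  by rewrite !midf_lt.
- by exists (r + 1); rewrite lte_fin ltrDl ltr01 ltry.
- by exists (s - 1); rewrite lte_fin ltrBlDr ltrDl ltr01 ltNyr.
- by exists 0; rewrite ltry ltNyr.
Qed.

(** If the supremum [M] were not attained, each point would have a neighbourhood on which [f] stays
    below some real [c < M]; compactness makes this bound uniform, contradicting the choice of
    [M]. *)
Lemma usc_attains_sup (R : realType) (T : topologicalType) (A : set T)
    (f : T -> \bar R) :
  compact A -> A !=set0 ->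
  (forall (x : T) (c : R), (f x < c%:E)%E -> \forall y \near x, (f y < c%:E)%E) ->
  exists2 x, A x & f x = ereal_sup (f @` A).
Proof.
move=> /compact_near_coveringP cA [x0 Ax0] usc; set M := ereal_sup _.
have f_le x : A x -> (f x <= M)%E by move=> Ax; apply: ereal_sup_ubound; exists x.
apply/not_exists2P => fne.
have f_lt x : A x -> (f x < M)%E.
  by move=> Ax; rewrite lt_neqAle f_le// andbT; apply/eqP; case: (fne x).
(* [F] is the filter of left neighbourhoods of [M]; the near-covering form of compactness is applied
   with it as parameter filter. *)
pose F := filter_from [set c | (c < M)%E] (fun c => [set a | (c <= a < M)%E]).
have FF : Filter F.
  apply: filter_from_filter; first by exists (f x0); exact: f_lt.
  move=> a b aM bM; exists (Order.max a b); first by rewrite /= gt_max aM bM.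
  by move=> c /=; rewrite ge_max => /andP[/andP[-> ->] ->].
have [|c cM Ac] := cA _ F (fun a x => A x -> (f x < a)%E) FF.
  move=> x Ax; have [c [xc cM]] := ereal_lt_dense (f_lt _ Ax).
  exists ([set y | (f y < c%:E)%E], [set a | (c%:E <= a < M)%E]).
    by split; [exact: usc | exists c%:E].
  by move=> [y a] /= [yc /andP[ca _]] _; exact: lt_le_trans ca.
have : (M <= c)%E.
  apply/ereal_supP => _ [x Ax <-]; apply/ltW/(Ac c) => //.
  by rewrite /= lexx.
by rewrite leNgt cM.
Qed.

Lemma compact_simplex (R : realType) (K : nat) : compact (@simplex R K).
Proof.
(* Each weight is at most the total mass 1, so the simplex is a closed subset of a compact cube. *)
have -> : @simplex R K =
    [set w | forall i, `[0, 1]%classic (w ord0 i)] `&`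
    [set w | \sum_(i < K) w ord0 i = 1].
  apply/seteqP; split => w /= [w0 w1]; split=> // i; last first.
    by have := w0 i; rewrite in_itv => /andP[].
  rewrite in_itv/= w0/= -w1 (bigD1 i)//= lerDl.
  by apply: sumr_ge0 => j _.
apply: compact_closedI.
  by apply: (@rV_compact R K (fun=> `[0, 1]%classic)) => i; exact: segment_compact.
apply: (@preimage_closed _ _ (fun w : 'rV[R]_K => \sum_(i < K) w ord0 i) [set 1]).
  move=> w _; apply: continuous_big w => [|i _]; first exact: add_continuous.
  exact: coord_continuous.
exact: closed_eq.
Qed.

Lemma simplex_neq0 (R : realType) (K : nat) : (0 < K)%N -> @simplex R K !=set0.
Proof.
move=> K0; exists (delta_mx ord0 (Ordinal K0)); split=> [i|].
  by rewrite mxE ler0n.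
rewrite (bigD1 (Ordinal K0))//= mxE !eqxx big1 ?addr0// => i /negbTE i0.
by rewrite mxE i0 andbF.
Qed.

(** * Transport costs and their infima over alternatives *)

Lemma transport_cost_ge0 (R : realType) (K : nat) (sigma : R)
    (w x y : 'rV[R]_K) : simplex w -> 0 <= transport_cost sigma w x y.
Proof.
move=> [w0 _]; apply: sumr_ge0 => i _; rewrite mulr_ge0// divr_ge0 ?sqr_ge0//.
by rewrite mulr_ge0// sqr_ge0.
Qed.

Lemma transport_costxx (R : realType) (K : nat) (sigma : R) (w x : 'rV[R]_K) :
  transport_cost sigma w x x = 0.
Proof. by apply: big1 => i _; rewrite subrr expr0n/= mul0r mulr0. Qed.

Lemma transport_cost_translate (R : realType) (K : nat) (sigma : R)
    (w x y d : 'rV[R]_K) :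
  transport_cost sigma w (x + d) (y + d) = transport_cost sigma w x y.
Proof. by apply: eq_bigr => i _; rewrite !mxE opprD addrACA subrr addr0. Qed.

Lemma continuous_transport_cost (R : realType) (K : nat) (sigma : R)
    (x y : 'rV[R]_K) : continuous (fun w => transport_cost sigma w x y).
Proof.
apply: continuous_big => [|i _ w]; first exact: add_continuous.
exact: cvgMl (@coord_continuous R 1 K ord0 i w).
Qed.

Lemma cvg_transport_cost_line (R : realType) (K : nat) (sigma : R)
    (w x y v : 'rV[R]_K) :
  transport_cost sigma w x (y + t *: v) @[t --> (0 : R)^'] -->
  transport_cost sigma w x y.
Proof.
apply: cvg_big => [|i _]; first exact: add_continuous.
apply: cvgMr; apply: cvgMl; rewrite !expr2.
have cxy : x ord0 i - (y + t *: v) ord0 i @[t --> (0 : R)^'] -->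
    x ord0 i - y ord0 i.
  apply: cvgB; first exact: cvg_cst.
  under eq_fun do rewrite !mxE.
  exact: cvg_affine0.
exact: cvgM.
Qed.

Lemma inf_cost_ge0 (R : realType) (K : nat) (istar : answer_map R K)
    (sigma : R) (w x : 'rV[R]_K) :
  simplex w -> (0 <= inf_cost istar sigma w x)%E.
Proof.
move=> sw; apply/ereal_infP => _ [lam _ <-].
by rewrite lee_fin transport_cost_ge0.
Qed.

Lemma inf_cost_tie_le0 (R : realType) (K : nat) (istar : answer_map R K)
    (sigma : R) (w x : 'rV[R]_K) :
  istar x = None -> (inf_cost istar sigma w x <= 0)%E.
Proof.
move=> xN; apply: ereal_inf_lbound; exists x; first by rewrite /alt xN.
by rewrite transport_costxx.
Qed.

(** An infimum of functions continuous in [w] is upper semicontinuous: an alternative that beats [c]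
    at [w] still beats it nearby. *)
Lemma inf_cost_usc (R : realType) (K : nat) (istar : answer_map R K)
    (sigma : R) (x w : 'rV[R]_K) (c : R) :
  (inf_cost istar sigma w x < c%:E)%E ->
  \forall w' \near w, (inf_cost istar sigma w' x < c%:E)%E.
Proof.
move=> /ereal_inf_ltP[_ [lam xlam <-]]; rewrite lte_fin => lamc.
have nlt := cvgr_lt _ (@continuous_transport_cost R K sigma x lam w) _ lamc.
apply: filterS (nlt _) => w' lamc'; apply/ereal_inf_ltP.
by exists (transport_cost sigma w' x lam)%:E; [exists lam | rewrite lte_fin].
Qed.

Lemma inf_cost_shift (R : realType) (K : nat) (istar : answer_map R K)
    (sigma : R) (w x y : 'rV[R]_K) (S : {set 'I_K}) :
  regular_answer istar -> istar x = Some S -> istar y = Some S ->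
  (forall i, i \in S -> x ord0 i <= y ord0 i) ->
  (forall i, i \notin S -> y ord0 i <= x ord0 i) ->
  (inf_cost istar sigma w x <= inf_cost istar sigma w y)%E.
Proof.
move=> [mono opn gen] xS yS le_xy le_yx.
apply/ereal_infP => _ [lam + <-]; rewrite /alt yS => -[S' lamS' S'S].
have cvg_cost : (transport_cost sigma w y (lam + t *: ramp R K))%:E
    @[t --> (0 : R)^'] --> (transport_cost sigma w y lam)%:E.
  by apply: cvg_EFin; [exact: nearW | exact: cvg_transport_cost_line].
have line : (fun t : R => lam + t *: ramp R K) @ (0 : R)^' --> lam.
  have {2}-> : lam = lam + 0 *: ramp R K by rewrite scale0r addr0.
  apply: cvgD; first exact: cvg_cst.
  by apply: cvgZr_tmp; exact: nbhs_dnbhs.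
(* It suffices to bound the cost of the perturbed alternatives, for small [t <> 0], and let [t] tend
   to 0. *)
apply: cvge_ge cvg_cost.
have near_S' : \forall t \near (0 : R)^', istar (lam + t *: ramp R K) = Some S'.
  exact: line (opn _ _ lamS').
apply: filterS2 (gen (lam + (x - y))) near_S' => t tgen tS'.
rewrite -(transport_cost_translate _ _ _ _ (x - y)) [y + _]addrC subrK.
apply: ereal_inf_lbound; exists (lam + t *: ramp R K + (x - y)) => //.
rewrite /alt xS; move: tgen; rewrite addrAC.
case tS'' : (istar _) => [S''|//] _; exists S'' => // S''S.
rewrite {}S''S in tS''.
(* Undoing the shift by [x - y] raises the arms of [S] and lowers the others, so answer [S] would
   survive, against [S' <> S]. *)
have : istar (lam + t *: ramp R K) = Some S.
  apply: mono tS'' _ _ => i iS; rewrite !mxE.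
    by rewrite gerDl subr_le0 le_xy.
  by rewrite lerDl subr_ge0 le_yx.
by rewrite tS' => -[].
Qed.

(** * Ties and the worst point of the ball *)

(** Connectedness of [[0, e]]: without a tie on the segment, the times with answer [S] and those
    with another answer are two relatively open sets covering it, so the first, which contains 0, is
    everything. *)
Lemma answer_change_tie (R : realType) (K : nat) (istar : answer_map R K)
    (x d : 'rV[R]_K) (S : {set 'I_K}) (e : R) :
  regular_answer istar -> 0 <= e -> istar x = Some S ->
  istar (x + e *: d) <> Some S ->
  exists2 t, 0 <= t <= e & istar (x + t *: d) = None.
Proof.
move=> reg e0 xS eS; apply/not_exists2P => no_tie.
pose path t := x + t *: d.
have cpath : continuous path.
  move=> t; apply: cvgD; first exact: cvg_cst.
  exact: scalel_continuous.
pose sameA := [set z : 'rV[R]_K | istar z = Some S].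
pose otherA := [set z : 'rV[R]_K | exists2 S', istar z = Some S' & S' <> S].
have osame : open (path @^-1` sameA).
  apply: open_comp => [t _|]; first exact: cpath.
  rewrite openE => z /= zS; exact: answer_open reg _ _ zS.
have oother : open (path @^-1` otherA).
  apply: open_comp => [t _|]; first exact: cpath.
  rewrite openE => z /= [S' zS' S'S].
  apply: filterS (answer_open reg zS') => z' z'S'; by exists S'.
have all_same : `[0, e] `&` path @^-1` sameA = `[0, e]%classic.
  apply: segment_connected.
  - exists 0; split; first by rewrite /= in_itv/= lexx.
    by rewrite /= /path scale0r addr0.
  - by exists (path @^-1` sameA).
  exists (~` (path @^-1` otherA)); first exact: open_closedC.
  apply/seteqP; split=> t [te]; rewrite /sameA /otherA /= => tS; split=> //.
    by move=> [S']; rewrite tS => -[->].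
  move: te; rewrite /= in_itv /= => te.
  case ts : (istar (path t)) => [S'|]; last by case: (no_tie t).
  by congr Some; apply: contrapT => S'S; apply: tS; exists S'.
have : `[0, e]%classic e by rewrite /= in_itv/= lexx e0.
by rewrite -all_same => -[].
Qed.

Lemma linfty_ballP (R : realType) (K : nat) (mu nu : 'rV[R]_K) (e : R) :
  0 <= e ->
  linfty_ball mu e nu <-> forall i, `|nu ord0 i - mu ord0 i| <= e.
Proof.
move=> e0; rewrite /linfty_ball /= [X in X <= _]/Num.norm/= mx_normrE; split.
  move=> /bigmax_leP[_ le_e] i; have := le_e (ord0, i) isT.
  by rewrite /= !mxE.
move=> le_e; apply/bigmax_leP; split=> // -[a i] _ /=.
by rewrite (ord1 a) !mxE.
Qed.

Lemma exists_worst_case (R : realType) (K : nat) (istar : answer_map R K)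
    (sigma : R) (mu : 'rV[R]_K) (e : R) :
  regular_answer istar -> 0 <= e ->
  exists2 nu, linfty_ball mu e nu &
    forall w nu', simplex w -> linfty_ball mu e nu' ->
      (inf_cost istar sigma w nu <= inf_cost istar sigma w nu')%E.
Proof.
move=> reg e0.
have [[nu nuB nuN]|no_tie] := pselect (exists2 nu, linfty_ball mu e nu & istar nu = None).
  exists nu => // w nu' sw _; apply: le_trans (inf_cost_ge0 _ _ _ sw).
  exact: inf_cost_tie_le0.
have muB : linfty_ball mu e mu by apply/linfty_ballP => // i; rewrite subrr normr0.
case muS : (istar mu) => [S|]; last by case: no_tie; exists mu.
pose d : 'rV[R]_K := \row_i (if i \in S then -1 else 1).
have pathB t : 0 <= t <= e -> linfty_ball mu e (mu + t *: d).
  move=> /andP[t0 te]; apply/linfty_ballP => // i; rewrite !mxE addrAC subrr add0r.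
  by rewrite normrM ger0_norm// (fun_if Num.norm) normrN normr1 if_same mulr1.
have nuB : linfty_ball mu e (mu + e *: d) by apply: pathB; rewrite e0 lexx.
have nuS : istar (mu + e *: d) = Some S.
  apply: contrapT => /(answer_change_tie reg e0 muS)[t te tN].
  by apply: no_tie; exists (mu + t *: d) => //; exact: pathB.
exists (mu + e *: d) => // w nu' sw /linfty_ballP-/(_ e0) nu'B.
have geS i : i \in S -> (mu + e *: d) ord0 i <= nu' ord0 i.
  by move=> iS; have := nu'B i; rewrite !mxE iS mulrN1 ler_distl => /andP[].
have leS i : i \notin S -> nu' ord0 i <= (mu + e *: d) ord0 i.
  move=> /negbTE iS; have := nu'B i.
  by rewrite !mxE iS mulr1 ler_distl => /andP[].
(* Monotonicity carries the answer [S] from the extreme point to every [nu'] of the ball, so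
   connectedness is used only on the segment from [mu] to that point. *)
exact: (inf_cost_shift _ _ reg nuS (answer_mono reg nuS geS leS) geS leS).
Qed.

Theorem lemma3p12 (R : realType) (K : nat) (K_gt0 : (0 < K)%N)
    (sigma : R) (sigma_gt0 : 0 < sigma) (istar : answer_map R K)
    (istarP : (exists2 k : nat, (1 <= k < K)%N & istar = top_k_answer k) \/
              (exists tau : R, istar = thresholding_answer tau))
    (mu : 'rV[R]_K) (eps : R) (eps_ge0 : 0 <= eps) :
  is_max [set robust_inf_cost istar sigma (linfty_ball mu eps) w
           | w in @simplex R K]
    (ereal_sup [set robust_inf_cost istar sigma (linfty_ball mu eps) w
                 | w in @simplex R K]) /\
  is_max [set Tstar istar sigma mu' | mu' in linfty_ball mu eps]
    (Tstar_bar istar sigma (linfty_ball mu eps)).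
Proof.
have reg : regular_answer istar.
  case: istarP => [[k kK ->]|[tau ->]]; first exact: top_k_answer_regular.
  exact: thresholding_answer_regular.
have [nu nuB worst] := exists_worst_case sigma mu reg eps_ge0.
(* For every weight the infimum over the ball is reached at the same [nu], so the robust objective
   is the plain objective at [nu]. *)
have eqT : [set robust_inf_cost istar sigma (linfty_ball mu eps) w
    | w in @simplex R K] = [set inf_cost istar sigma w nu | w in @simplex R K].
  apply: eq_imagel => w sw; apply/eqP; rewrite eq_le; apply/andP; split.
    by apply: ereal_inf_lbound; exists nu.
  by apply/ereal_infP => _ [nu' nu'B <-]; exact: worst.
split.
  rewrite eqT; split; last exact: ereal_sup_ubound.
  have [w sw <-] := usc_attains_sup (@compact_simplex R K)
    (simplex_neq0 R K_gt0) (@inf_cost_usc R K istar sigma nu).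
  by exists w.
(* Inversion reverses the order on nonnegative extended reals, including [0^-1 = +oo]; hence the
   sign of the suprema is recorded first. *)
have sup_ge0 x : (0 <= ereal_sup [set inf_cost istar sigma w x | w in @simplex R K])%E.
  have [w sw] := simplex_neq0 R K_gt0.
  apply: le_trans (inf_cost_ge0 istar sigma x sw) _.
  by apply: ereal_sup_ubound; exists w.
rewrite /Tstar_bar eqT; split; first by exists nu.
move=> _ [nu' nu'B <-]; rewrite /Tstar lee_pV2 ?inE ?sup_ge0//.
apply/ereal_supP => _ [w sw <-]; apply: le_trans (worst _ _ sw nu'B) _.
by apply: ereal_sup_ubound; exists w.
Qed.
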